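(* Let $T\in(0,\infty)$, let $(\Omega,\mathcal F,\mathbb P)$ be a probability space, let $(E,\|\cdot\|_E)$ be an $\mathbb R$-Banach space, let $\beta\in(0,1]$, and let $X\colon[0,T]\times\Omega\to E$ and $Y^N\colon[0,T]\times\Omega\to E$, $N\in\mathbb N=\{1,2,\dots\}$, be $(\mathcal F,\|\cdot\|_E)$-strongly measurable stochastic processes with continuous sample paths which satisfy for all $p\in(1,\infty)$ that $\forall\,N\in\mathbb N\colon Y^N=[Y^N]_N$ and $$\|X\|_{\mathcal C^\beta([0,T],\|\cdot\|_{\mathcal L^p(\mathbb P;\|\cdot\|_E)})}+\sup_{N\in\mathbb N}\Bigl[N^\beta\sup_{n\in\{0,1,\dots,N\}}\bigl\|X_{\frac{nT}N}-Y^N_{\frac{nT}N}\bigr\|_{\mathcal L^p(\mathbb P;\|\cdot\|_E)}\Bigr]<\infty.$$ Then for all $p,\varepsilon\in(0,\infty)$ it holds that $$\sup_{N\in\mathbb N}\Bigl[N^{\beta-\varepsilon}\Bigl(\mathbb E\Bigl[\sup_{t\in[0,T]}\|X_t-Y^N_t\|_E^p\Bigr]\Bigr)^{1/p}\Bigr]<\infty.$$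
   Context: For a function $f\colon[0,T]\to E$ and $N\in\mathbb N$, $[f]_N\colon[0,T]\to E$ is the piecewise affine linear interpolation: for all $n\in\{0,1,\dots,N-1\}$, $t\in[\frac{nT}N,\frac{(n+1)T}N]$, $[f]_N(t)=(n+1-\frac{tN}T)f(\frac{nT}N)+(\frac{tN}T-n)f(\frac{(n+1)T}N)$; for a process it is applied to each sample path. A stochastic process $X\colon[0,T]\times\Omega\to E$ is $(\mathcal F,\|\cdot\|_E)$-strongly measurable if each $X_t\colon\Omega\to E$ is strongly measurable. For a strongly measurable $Z\colon\Omega\to E$ put $\|Z\|_{\mathcal L^p(\mathbb P;\|\cdot\|_E)}=(\mathbb E[\|Z\|_E^p])^{1/p}\in[0,\infty]$. For a process $X$ and $r\in[0,1]$, $\|X\|_{\mathcal C^r([0,T],\|\cdot\|_{\mathcal L^p(\mathbb P;\|\cdot\|_E)})}=\sup_{t\in[0,T]}\|X_t\|_{\mathcal L^p(\mathbb P;\|\cdot\|_E)}+\sup_{s,t\in[0,T],\,s\ne t}\frac{\|X_t-X_s\|_{\mathcal L^p(\mathbb P;\|\cdot\|_E)}}{|t-s|^r}\in[0,\infty]$. *)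

(* Defs.v *)
From mathcomp Require Import all_boot all_order all_algebra.
From mathcomp Require Import all_classical all_reals all_analysis.

Set Implicit Arguments.
Unset Strict Implicit.
Unset Printing Implicit Defensive.

Import Order.TTheory GRing.Theory Num.Theory.
Import numFieldNormedType.Exports.

Local Open Scope classical_set_scope.
Local Open Scope ring_scope.

(* A process on [0, T] is a total function R -> Omega -> E; its values at
   times outside [0, T] are junk which none of the notions below look at. *)

Section interpolation.
Context {R : realType} {E : normedModType R}.

(* The index is truncated at N - 1 so that the endpoint t = T belongs to the
   last piece and only values of f on [0, T] are used (see interpE). *)
Definition interp (T : R) (N : nat) (f : R -> E) (t : R) : E :=
  let n := minn (Num.truncn (t * N%:R / T)) N.-1 in
  (n.+1%:R - t * N%:R / T) *: f (n%:R * T / N%:R) +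
  (t * N%:R / T - n%:R) *: f (n.+1%:R * T / N%:R).

Lemma interpE (T : R) (N n : nat) (f : R -> E) (t : R) :
  0 < T -> (n < N)%N -> t \in `[n%:R * T / N%:R, n.+1%:R * T / N%:R] ->
  interp T N f t =
  (n.+1%:R - t * N%:R / T) *: f (n%:R * T / N%:R) +
  (t * N%:R / T - n%:R) *: f (n.+1%:R * T / N%:R).
Proof.
move=> T0 nN; have N0 : 0 < N%:R :> R by rewrite ltr0n (leq_ltn_trans _ nN).
rewrite in_itv /= (ler_pdivrMr _ _ N0) (ler_pdivlMr _ _ N0).
rewrite -(ler_pdivlMr _ _ T0) -(ler_pdivrMr _ _ T0) /interp.
set x := t * N%:R / T => /andP[nx].
rewrite le_eqVlt => /predU1P[xE|xn]; last first.
  have -> : Num.truncn x = n by apply: truncn_def; rewrite nx.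
  by rewrite (minn_idPl _)// -ltnS prednK// (leq_ltn_trans _ nN).
have -> : Num.truncn x = n.+1 by rewrite xE natrK.
rewrite xE; move: nN; rewrite leq_eqVlt => /predU1P[<-|nN].
  by rewrite (minn_idPr _).
rewrite (minn_idPl _); last by rewrite -ltnS prednK// (leq_ltn_trans _ nN).
by rewrite subrr !scale0r addr0 add0r -!natrB// !subSnn.
Qed.

End interpolation.

Section processes.
Context {d : measure_display} {Omega : measurableType d} {R : realType}.
Context {E : normedModType R}.

Definition simple_function (s : Omega -> E) : Prop :=
  finite_set (range s) /\ forall x, measurable (s @^-1` [set x]).

Definition strongly_measurable (Z : Omega -> E) : Prop :=
  exists s : nat -> Omega -> E,
    (forall k, simple_function (s k)) /\
    (forall w, s ^~ w @ \oo --> Z w).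

Definition continuous_paths (T : R) (X : R -> Omega -> E) : Prop :=
  forall w, {within `[0, T], continuous (X ^~ w)}.

Local Open Scope ereal_scope.

Definition LpE (P : probability Omega R) (p : R) (Z : Omega -> E) : \bar R :=
  'N[P]_p%:E[(fun w => `|Z w|%:E)].

Definition holder_norm (P : probability Omega R) (T r p : R)
    (X : R -> Omega -> E) : \bar R :=
  ereal_sup [set LpE P p (X t) | t in `[0%R, T]] +
  ereal_sup [set LpE P p (fun w => X u.2 w - X u.1 w)%R
                 * ((`|u.2 - u.1| `^ r)^-1)%:E |
             u in [set u : R * R | [/\ u.1 \in `[0%R, T], u.2 \in `[0%R, T]
                                     & u.1 != u.2]]].

End processes.

(* Main.v *)
(* Let q be large. The Hoelder bound in L^q makes the sum of the q-th powers of
   the increments of X over the grid of mesh T / (N 2^k) have expectation of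
   order (N 2^k)^(1 - beta q); the sum of |X - Y|^q over the nodes has
   expectation of order N^(1 - beta q). Summing over k with suitable weights
   gives a random variable with expectation of order N^(1 - beta q) whose q-th
   root controls, path by path and up to a geometric factor in k, all dyadic
   increments and all nodal errors. Chaining along the dyadic floors of t and
   continuity of the paths bound sup_t |X_t - Y_t| by that q-th root. Hence the
   error in L^q, and in L^p for p <= q, is of order N^(1/q - beta), and 1/q is
   at most epsilon. *)
Require Import Defs.
From mathcomp Require Import all_boot all_order all_algebra.
From mathcomp Require Import all_classical all_reals all_analysis.
From mathcomp Require Import measurable_realfun lra ring.

Set Implicit Arguments.
Unset Strict Implicit.
Unset Printing Implicit Defensive.

Import Order.TTheory GRing.Theory Num.Theory.
Import numFieldNormedType.Exports.
Local Open Scope classical_set_scope.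
Local Open Scope ring_scope.

(** * Dyadic chaining along a single path *)

Lemma truncn_double (R : realType) (x : R) : 0 <= x ->
  Num.truncn (x * 2) = (Num.truncn x).*2 \/
  Num.truncn (x * 2) = (Num.truncn x).*2.+1.
Proof.
move=> x0; have /andP[mx xm] := truncn_itv x0.
have [h|h] := ltP (x * 2) ((Num.truncn x).*2.+1%:R).
  left; apply: truncn_def; rewrite h andbT -muln2 natrM.
  by rewrite ler_pM2r.
right; apply: truncn_def; rewrite h/=.
by rewrite -doubleS -muln2 natrM ltr_pM2r.
Qed.

Section dyadic_chaining.
Variables (R : realType) (E : normedModType R).
Variables (T : R) (N : nat) (T_gt0 : 0 < T) (N_gt0 : (0 < N)%N).

Let NR_gt0 k : 0 < (N * 2 ^ k)%:R :> R.
Proof. by rewrite ltr0n muln_gt0 N_gt0 expn_gt0. Qed.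

Let idx (t : R) (k : nat) := Num.truncn (t * (N * 2 ^ k)%:R / T).
Let pt (j k : nat) : R := j%:R * T / (N * 2 ^ k)%:R.

Let idx_le t k : 0 <= t <= T -> (idx t k <= N * 2 ^ k)%N.
Proof.
move=> /andP[t0 tT]; rewrite /idx truncn_le_nat.
rewrite ltr_pdivrMr// (@le_lt_trans _ _ ((N * 2 ^ k)%:R * T))//.
  by rewrite mulrC ler_pM2l.
by rewrite ltr_pM2r// ltr_nat.
Qed.

Let idx_dist t k : 0 <= t <= T -> `|pt (idx t k) k - t| <= T / (N * 2 ^ k)%:R.
Proof.
move=> /andP[t0 tT]; rewrite /pt /idx.
have x0 : 0 <= t * (N * 2 ^ k)%:R / T by rewrite divr_ge0 ?mulr_ge0// ltW.
have /andP[mx xm] := truncn_itv x0.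
set m := Num.truncn _ in mx xm *.
move: mx; rewrite ler_pdivlMr// => mx.
move: xm; rewrite ltr_pdivrMr// -natr1 mulrDl mul1r => xm.
rewrite ler_distl; apply/andP; split.
  by rewrite lerBlDr -mulrDl ler_pdivlMr// ltW.
rewrite ler_pdivrMr// mulrDl divfK ?gt_eqF//.
by rewrite (le_trans mx)// lerDl ltW.
Qed.

Let ptS j k : pt j.*2 k.+1 = pt j k.
Proof.
rewrite /pt expnS mulnCA -muln2 !natrM; field.
by rewrite !gt_eqF//= ?ltr0n ?expn_gt0.
Qed.

(** The differences of [f] between floors of [t] at successive levels telescope and are dominated by
    a geometric series. The floors converge to [t], so continuity of [f] transfers the bound to
    [f t]. *)
Lemma dist_floor_le (f : R -> E) (c rho : R) (t : R) :
  {within `[0, T], continuous f} -> 0 <= c -> 0 <= rho < 1 ->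
  (forall k j, (j < N * 2 ^ k)%N ->
     `|f (j.+1%:R * T / (N * 2 ^ k)%:R) - f (j%:R * T / (N * 2 ^ k)%:R)|
       <= c * rho ^+ k) ->
  0 <= t <= T ->
  `|f t - f ((Num.truncn (t * N%:R / T))%:R * T / N%:R)| <= c / (1 - rho).
Proof.
move=> fc c0 /andP[r0 r1] inc tT.
have q0 : 0 < 1 - rho by rewrite subr_gt0.
have step k : `|f (pt (idx t k.+1) k.+1) - f (pt (idx t k) k)| <= c * rho ^+ k.
  have x0 : 0 <= t * (N * 2 ^ k)%:R / T.
    by case/andP: tT => t0 _; rewrite divr_ge0 ?mulr_ge0// ltW.
  have iE : idx t k.+1 = Num.truncn (t * (N * 2 ^ k)%:R / T * 2).
    by congr Num.truncn; rewrite expnS mulnCA natrM; ring.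
  (* Halving the mesh doubles the rescaled time, so the floor of [t] either stays at the same point
     or moves to the next point of the finer grid. In the second case a single increment of level
     [k.+1] is crossed. *)
  have [h|h] := truncn_double x0.
    rewrite iE h ptS subrr normr0.
    by rewrite mulr_ge0 ?exprn_ge0.
  have := idx_le k.+1 tT; rewrite iE h -/(idx t k) => lt.
  rewrite -(ptS (idx t k) k); apply: (le_trans (inc k.+1 _ lt)).
  by rewrite ler_wpM2l// exprS ler_piMl ?exprn_ge0//; exact: ltW.
(* The closed form of the partial geometric sum carries the induction; the uniform bound alone would
   not. *)
have chain K : `|f (pt (idx t K) K) - f (pt (idx t 0) 0)|
    <= c * (1 - rho ^+ K) / (1 - rho).
  elim: K => [|K IH]; first by rewrite expr0 !subrr normr0 mulr0 mul0r.
  have -> : f (pt (idx t K.+1) K.+1) - f (pt (idx t 0) 0) =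
     (f (pt (idx t K.+1) K.+1) - f (pt (idx t K) K)) +
     (f (pt (idx t K) K) - f (pt (idx t 0) 0)) by rewrite addrA subrK.
  apply: (le_trans (ler_normD _ _)); apply: (le_trans (lerD (step K) IH)).
  rewrite le_eqVlt; apply/orP; left; apply/eqP; rewrite exprS; field.
  by rewrite gt_eqF.
have {chain}chain K : `|f (pt (idx t K) K) - f (pt (idx t 0) 0)| <= c / (1 - rho).
  apply: (le_trans (chain K)); rewrite ler_pM2r ?invr_gt0//.
  by rewrite ler_piMr// gerBl exprn_ge0.
have -> : (Num.truncn (t * N%:R / T))%:R * T / N%:R = pt (idx t 0) 0.
  by rewrite /pt /idx expn0 muln1.
apply/ler_addgt0Pr => e e0.
have /subspace_continuousP/(_ t) := fc.
rewrite /= in_itv/= tT => /(_ isT)/cvgrPdist_lt/(_ e e0).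
rewrite /within/= nearE => -[del /= del0 H].
have [K HK] : exists K : nat, T / (N * 2 ^ K)%:R < del.
  (* For this [K] one has [T / del < K + 1 <= 2 ^ K <= N * 2 ^ K]. *)
  exists (Num.truncn (T / del)).
  rewrite ltr_pdivrMr// mulrC -ltr_pdivrMr// (lt_le_trans (truncnS_gt _))//.
  rewrite ler_nat (leq_trans (ltn_expl _ (ltnSn 1)))//.
  by rewrite leq_pmull.
have pin : pt (idx t K) K \in `[0, T].
  rewrite in_itv/=; apply/andP; split.
    by rewrite /pt divr_ge0 ?mulr_ge0// ltW.
  by rewrite /pt ler_pdivrMr// mulrC ler_pM2l// ler_nat idx_le.
have := H (pt (idx t K) K).
rewrite /ball_/= distrC (le_lt_trans (idx_dist K tT) HK) => /(_ isT).
rewrite /= => /(_ pin) fK.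
rewrite -(subrKA (f (pt (idx t K) K))) (le_trans (ler_normD _ _))// addrC.
by rewrite lerD// ltW.
Qed.

(** The interpolant is a convex combination of two node values of [g], so it suffices to bound the
    distance from [f t] to each. Reaching the floor of [t] costs [c / (1 - rho)]; at most one grid
    step and the nodal error cost [c] each. *)
Lemma interp_dist_le (f g : R -> E) (c rho : R) (t : R) :
  {within `[0, T], continuous f} -> 0 <= c -> 0 <= rho < 1 ->
  (forall k j, (j < N * 2 ^ k)%N ->
     `|f (j.+1%:R * T / (N * 2 ^ k)%:R) - f (j%:R * T / (N * 2 ^ k)%:R)|
       <= c * rho ^+ k) ->
  (forall n, (n <= N)%N ->
     `|f (n%:R * T / N%:R) - g (n%:R * T / N%:R)| <= c) ->
  0 <= t <= T ->
  `|f t - interp T N g t| <= c * (2 + (1 - rho)^-1).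
Proof.
move=> fc c0 r01 inc fg tT.
have d0 := @dist_floor_le f c rho t fc c0 r01 inc tT.
set x := t * N%:R / T in d0; set m := Num.truncn x in d0.
have N0 : 0 < N%:R :> R by rewrite ltr0n.
have x0 : 0 <= x by case/andP: tT => t0 _; rewrite divr_ge0 ?mulr_ge0// ltW.
have xN : x <= N%:R.
  by case/andP: tT => t0 tT; rewrite /x ler_pdivrMr// mulrC ler_pM2l.
have mN : (m <= N)%N by rewrite /m truncn_le_nat (le_lt_trans xN)// ltr_nat.
have /andP[mx xm] := truncn_itv x0; rewrite -/m in mx xm.
rewrite /interp -/x -/m; set n := minn m N.-1.
have nN : (n < N)%N by rewrite /n (leq_ltn_trans (geq_minr _ _))// ltn_predL.
have incr j : (j < N)%N ->
    `|f (j.+1%:R * T / N%:R) - f (j%:R * T / N%:R)| <= c.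
  by move=> jN; have := inc 0 j; rewrite expn0 muln1 expr0 mulr1; exact.
have nx : n%:R <= x by rewrite (le_trans _ mx)// ler_nat geq_minl.
have xn : x <= n.+1%:R.
  rewrite /n; case: (leqP m N.-1) => _; first exact: ltW.
  by rewrite prednK.
(* The floor [m] exceeds the truncated index [n] only at [t = T], where [m = N] and [n = N - 1]. *)
have mn : m = n \/ m = n.+1.
  rewrite /n; case: (leqP m N.-1) => h; [by left|right].
  by apply/eqP; rewrite eqn_leq h andbT prednK.
have near i : i = n \/ i = n.+1 ->
    `|f t - g (i%:R * T / N%:R)| <= c * (2 + (1 - rho)^-1).
  move=> hi; have iN : (i <= N)%N by case: hi => ->//; exact: ltnW.
  have mi : `|f (m%:R * T / N%:R) - f (i%:R * T / N%:R)| <= c.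
    case: mn hi => -> [] ->; rewrite ?subrr ?normr0//; last exact: incr.
    by rewrite distrC; exact: incr.
  rewrite -(subrKA (f (i%:R * T / N%:R))) (le_trans (ler_normD _ _))//.
  rewrite -(subrKA (f (m%:R * T / N%:R))).
  have := ler_normD (f t - f (m%:R * T / N%:R))
            (f (m%:R * T / N%:R) - f (i%:R * T / N%:R)).
  have := fg _ iN.
  lra.
have wsum : n.+1%:R - x + (x - n%:R) = 1 by rewrite -natr1; ring.
have -> : f t = (n.+1%:R - x) *: f t + (x - n%:R) *: f t.
  by rewrite -scalerDl wsum scale1r.
rewrite opprD addrACA -!scalerBr (le_trans (ler_normD _ _))// !normrZ.
rewrite !ger0_norm ?subr_ge0//.
apply: (@le_trans _ _ ((n.+1%:R - x) * (c * (2 + (1 - rho)^-1)) +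
  (x - n%:R) * (c * (2 + (1 - rho)^-1)))).
  by rewrite lerD// ler_wpM2l ?subr_ge0//; apply: near; [left|right].
by rewrite -mulrDl wsum mul1r.
Qed.

End dyadic_chaining.

(** * Tools: splitting of powers, monotonicity of integrals, measurability *)

Lemma powR_le_split (R : realType) (u a p q : R) : 0 <= u -> 0 < a ->
  0 < p -> p <= q -> u `^ p <= a `^ p + a `^ (p - q) * u `^ q.
Proof.
move=> u0 a0 p0 pq.
have [ua|au] := leP u a.
  by rewrite ler_wpDr ?mulr_ge0 ?powR_ge0// ge0_ler_powR ?nnegrE// ltW.
(* Above the threshold [a] the second term suffices: as the exponent [p - q] is nonpositive, the
   power p - q of [u] is at most that of [a]. *)
have u_gt0 : 0 < u := lt_trans a0 au.
rewrite ler_wpDl ?powR_ge0//.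
have -> : u `^ p = u `^ (p - q) * u `^ q.
  by rewrite -powRD ?subrK//; apply/implyP => _; rewrite gt_eqF.
rewrite ler_wpM2r ?powR_ge0//.
rewrite -(opprB q p) !powRN lef_pV2 ?posrE ?powR_gt0//.
by rewrite ge0_ler_powR ?nnegrE ?subr_ge0// ltW.
Qed.

(* Unlike [ge0_le_integral], no measurability is assumed: an uncountable
   supremum will be compared with a measurable majorant. *)
Lemma ge0_le_integralT d (Omega : measurableType d) (R : realType)
  (mu : {measure set Omega -> \bar R}) (f g : Omega -> \bar R) :
  (forall w, 0 <= f w)%E -> (forall w, f w <= g w)%E ->
  (\int[mu]_w f w <= \int[mu]_w g w)%E.
Proof.
move=> f0 fg; have g0 w : (0 <= g w)%E := le_trans (f0 w) (fg w).
rewrite !ge0_integralTE//; apply: ereal_sup_le => _ [h hf <-].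
by exists h => // w; exact: le_trans (hf w) (fg w).
Qed.

(** [E] carries no sigma-algebra, so measurability is checked on the real-valued norm. For simple
    approximants a preimage is a finite union over pairs of values; the general case is a pointwise
    limit. *)
Lemma measurable_norm_sub d (Omega : measurableType d) (R : realType)
  (E : normedModType R) (Z1 Z2 : Omega -> E) :
  strongly_measurable Z1 -> strongly_measurable Z2 ->
  measurable_fun setT (fun w => `|Z1 w - Z2 w|).
Proof.
move=> [s1 [ss1 cs1]] [s2 [ss2 cs2]].
apply: (@measurable_fun_cvg _ _ _ _ (fun k w => `|s1 k w - s2 k w|)); last first.
  by move=> w _; apply: cvg_norm; apply: cvgB; [exact: cs1|exact: cs2].
move=> k _ B mB; rewrite setTI.
have [[fin1 m1] [fin2 m2]] := (ss1 k, ss2 k).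
have -> : (fun w => `|s1 k w - s2 k w|) @^-1` B =
  \bigcup_(x in range (s1 k)) \bigcup_(y in range (s2 k) `&` [set y | B `|x - y|])
     (s1 k @^-1` [set x] `&` s2 k @^-1` [set y]).
  apply/seteqP; split=> [w Bw|w [x _ [y [_ By]] [/= -> ->]]]; last by [].
  exists (s1 k w); first by exists w.
  by exists (s2 k w) => //; split => //; exists w.
apply: fin_bigcup_measurable => // x _.
apply: fin_bigcup_measurable; first exact: finite_setIl.
by move=> y _; apply: measurableI.
Qed.

(** * The energy and its control of the path *)

Section energy.
Context {d : measure_display} {Omega : measurableType d} {R : realType}.
Context {E : normedModType R}.
Variables (P : probability Omega R) (T : R) (T_gt0 : 0 < T).
Implicit Types (X Y : R -> Omega -> E).

Lemma LpE_moment (q C : R) (Z : Omega -> E) : 0 < q -> 0 <= C ->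
  (LpE P q Z <= C%:E -> \int[P]_w (`|Z w| `^ q)%:E <= (C `^ q)%:E)%E.
Proof.
move=> q0 C0 ZC.
have := @gt0_ler_poweR R q (ltW q0) (LpE P q Z) C%:E.
rewrite !in_itv/= !leey !andbT Lnorm_ge0 lee_fin => /(_ isT C0 ZC).
rewrite /LpE /= poweR_Lnorm ?gt_eqF//; apply: le_trans.
rewrite le_eqVlt; apply/orP; left; apply/eqP.
by apply: eq_integral => w _ /=; rewrite normr_id.
Qed.

Definition node_error (N : nat) (q : R) X Y (w : Omega) : \bar R :=
  (\sum_(n < N.+1)
     (`|X (n%:R * T / N%:R) w - Y (n%:R * T / N%:R) w| `^ q)%:E)%E.

Definition dyadic_incr (N : nat) (q : R) X (k : nat) (w : Omega) : \bar R :=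
  (\sum_(j < N * 2 ^ k)
     (`|X (j.+1%:R * T / (N * 2 ^ k)%:R) w
        - X (j%:R * T / (N * 2 ^ k)%:R) w| `^ q)%:E)%E.

(* When moments of order q of increments scale like the power gam of the mesh,
   level k of the unweighted sum has size 2^(k (1 - gam)); the weight
   2^(k gam / 2) still leaves a summable series, and makes a finite energy
   bound the increments of level k by a geometric sequence in k. *)
Definition energy (N : nat) (q gam : R) X Y (w : Omega) : \bar R :=
  (node_error N q X Y w +
   \sum_(k <oo) (((2 ^ k)%:R `^ (gam / 2))%:E * dyadic_incr N q X k w))%E.

Let node_error_ge0 N q X Y w : (0 <= node_error N q X Y w)%E.
Proof. by rewrite sume_ge0. Qed.

Let dyadic_incr_ge0 N q X k w : (0 <= dyadic_incr N q X k w)%E.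
Proof. by rewrite sume_ge0. Qed.

Let grid_in (m j : nat) : (j <= m)%N -> (0 < m)%N ->
  j%:R * T / m%:R \in `[0, T].
Proof.
move=> jm m0; have m0' : 0 < m%:R :> R by rewrite ltr0n.
rewrite in_itv/=; apply/andP; split; first by rewrite divr_ge0// mulr_ge0// ltW.
by rewrite ler_pdivrMr// mulrC ler_pM2l// ler_nat.
Qed.

Let level_ge0 N q gam X k w :
  (0 <= ((2 ^ k)%:R `^ (gam / 2))%:E * dyadic_incr N q X k w)%E.
Proof. by rewrite mule_ge0// lee_fin powR_ge0. Qed.

Lemma energy_ge0 N q gam X Y w : (0 <= energy N q gam X Y w)%E.
Proof. by rewrite adde_ge0// nneseries_ge0. Qed.

(** Every nodal error and every weighted increment, to the power [q], is dominated by a nonnegative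
    sum and hence by the energy [s]. Taking q-th roots yields the hypotheses of [interp_dist_le]
    with c = s^(1/q). *)
Lemma dist_interp_le_energy (N : nat) (q beta : R) X Y (w : Omega) (t : R) :
  (0 < N)%N -> 0 < q -> 0 < beta ->
  {within `[0, T], continuous (X ^~ w)} -> 0 <= t <= T ->
  ((`|X t w - interp T N (Y ^~ w) t| `^ q)%:E <=
   ((2 + (1 - 2 `^ (- (beta / 2)))^-1) `^ q)%:E *
     energy N q (beta * q) X Y w)%E.
Proof.
move=> N0 q0 b0 Xc tT; set rho := 2 `^ _; set B := 2 + _.
have r01 : 0 <= rho < 1.
  rewrite powR_ge0/= /rho powRN invf_lt1 ?powR_gt0//.
  by rewrite /powR pnatr_eq0/= expR_gt1 mulr_gt0 ?ln_gt0 ?divr_gt0// ltr1n.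
have B0 : 0 < B.
  by rewrite addr_gt0// invr_gt0 subr_gt0; case/andP: r01.
have root_le (u v : R) : 0 <= u -> 0 <= v -> u `^ q <= v -> u <= v `^ q^-1.
  move=> u0 v0 uv.
  have -> : u = (u `^ q) `^ q^-1 by rewrite -powRrM mulfV ?gt_eqF// powRr1.
  by rewrite ge0_ler_powR ?nnegrE ?powR_ge0// invr_ge0 ltW.
have e0 := energy_ge0 N q (beta * q) X Y w.
(* If the energy is infinite, so is the right-hand side, its coefficient being positive. *)
case eE : (energy _ _ _ _ _ _) e0 => [s||] // e0; last first.
  by rewrite gt0_muley ?leey// lte_fin powR_gt0.
have s0 : 0 <= s by rewrite -lee_fin.
rewrite -EFinM lee_fin.
have -> : s = (s `^ q^-1) `^ q by rewrite -powRrM mulVf ?gt_eqF// powRr1.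
rewrite -powRM ?powR_ge0 ?(ltW B0)//.
rewrite ge0_ler_powR ?nnegrE ?(ltW q0)//; first by rewrite mulr_ge0 ?powR_ge0 ?ltW.
rewrite [leRHS]mulrC.
apply: (@interp_dist_le _ _ _ _ T_gt0 N0 (X ^~ w) (Y ^~ w) _ rho) => //;
  rewrite ?powR_ge0//.
- move=> k j jN.
  have W0 : 0 < (2 ^ k)%:R :> R by rewrite ltr0n expn_gt0.
  have W1 : 0 < (2 ^ k)%:R `^ (beta * q / 2) by rewrite powR_gt0.
  (* With gam = beta q, the q-th root of the weight 2^(k gam / 2) is 2^(k beta / 2); this dictates
     the value of [rho]. *)
  have -> : s `^ q^-1 * rho ^+ k = (s / (2 ^ k)%:R `^ (beta * q / 2)) `^ q^-1.
    rewrite powRM// ?invr_ge0 ?powR_ge0//; congr (_ * _).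
    rewrite -powRN -powRrM -powR_mulrn ?powR_ge0// /rho -powRrM natrX.
    rewrite -powR_mulrn// -powRrM; congr (_ `^ _); field.
    by rewrite gt_eqF.
  apply: root_le => //; first by rewrite divr_ge0// ltW.
  rewrite ler_pdivlMr// -lee_fin EFinM muleC.
  rewrite -eE /energy (le_trans _ (leeDr _ _))//.
  (* The partial sum is cut at [k.+1] so that level [k] is its last term. *)
  have le_series := @nneseries_lim_ge R _ xpredT 0 k.+1
    (fun k _ _ => level_ge0 N q (beta * q) X k w).
  apply: le_trans le_series.
  rewrite big_nat_recr//= (le_trans _ (leeDr _ _))//; last first.
    by apply: sume_ge0 => i _; exact: level_ge0.
  rewrite lee_pmul2l// ?lte_fin//.
  by rewrite /dyadic_incr (bigD1 (Ordinal jN))//= leeDl// sume_ge0.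
- move=> n nN; apply: root_le => //.
  rewrite -lee_fin -eE /energy.
  rewrite (le_trans _ (leeDl _ _)) ?nneseries_ge0//.
  have nN1 : (n < N.+1)%N by [].
  by rewrite /node_error (bigD1 (Ordinal nN1))//= leeDl// sume_ge0.
Qed.

(** * Expectation of the energy *)

Section moments.
Variables (N : nat) (q gam A : R) (X Y : R -> Omega -> E).
Hypotheses (N_gt0 : (0 < N)%N) (gam_ge4 : 4 <= gam) (A_ge0 : 0 <= A).
Hypothesis X_meas : forall t, t \in `[0, T] -> strongly_measurable (X t).
Hypothesis Y_meas : forall t, t \in `[0, T] -> strongly_measurable (Y t).

Let mpow (Z1 Z2 : Omega -> E) :
  strongly_measurable Z1 -> strongly_measurable Z2 ->
  measurable_fun setT (fun w => (`|Z1 w - Z2 w| `^ q)%:E).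
Proof.
move=> m1 m2; apply/measurable_EFinP.
apply: (@measurableT_comp _ _ _ _ _ _ (@powR R ^~ q)) => //.
exact: measurable_norm_sub.
Qed.

Let minc k j : (j < N * 2 ^ k)%N ->
  measurable_fun setT (fun w => (`|X (j.+1%:R * T / (N * 2 ^ k)%:R) w
          - X (j%:R * T / (N * 2 ^ k)%:R) w| `^ q)%:E).
Proof.
move=> jN; have h0 : (0 < N * 2 ^ k)%N by exact: leq_ltn_trans jN.
by apply: mpow; apply/X_meas/grid_in => //; exact: ltnW.
Qed.

Let merr n : (n < N.+1)%N ->
  measurable_fun setT (fun w =>
    (`|X (n%:R * T / N%:R) w - Y (n%:R * T / N%:R) w| `^ q)%:E).
Proof.
by move=> nN; apply: mpow; [apply/X_meas/grid_in|apply/Y_meas/grid_in].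
Qed.

Let mnode : measurable_fun setT (node_error N q X Y).
Proof. by apply: emeasurable_sum => n; exact: merr. Qed.

Let mdyadic k : measurable_fun setT (dyadic_incr N q X k).
Proof. by apply: emeasurable_sum => j; exact: minc. Qed.

Let mlevel k : measurable_fun setT
  (fun w => (((2 ^ k)%:R `^ (gam / 2))%:E * dyadic_incr N q X k w)%E).
Proof. exact: measurable_funeM. Qed.

Let mseries : measurable_fun setT (fun w =>
  (\sum_(k <oo) (((2 ^ k)%:R `^ (gam / 2))%:E * dyadic_incr N q X k w))%E).
Proof. by apply: ge0_emeasurable_sum => // k _; exact: mlevel. Qed.

Lemma measurable_energy : measurable_fun setT (energy N q gam X Y).
Proof. exact: emeasurable_funD. Qed.

Hypothesis X_moment : forall s t, s \in `[0, T] -> t \in `[0, T] -> s != t ->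
  (\int[P]_w (`|X t w - X s w| `^ q)%:E <= (A * `|t - s| `^ gam)%:E)%E.
Hypothesis XY_moment : forall n, (n <= N)%N ->
  (\int[P]_w (`|X (n%:R * T / N%:R) w - Y (n%:R * T / N%:R) w| `^ q)%:E
    <= (A * N%:R `^ (- gam))%:E)%E.

(** There are N 2^k increments, each of moment at most A (T / (N 2^k))^gam. With the weight, the
    factor depending on [k] is 2^(k (1 - gam / 2)), at most 2^(-k) because gam is at least 4. The
    bound is written over 2^(k + 1) to match the geometric series summed afterwards. *)
Lemma level_moment_le k :
  (((2 ^ k)%:R `^ (gam / 2))%:E *
     \sum_(j < N * 2 ^ k)
       \int[P]_w (`|X (j.+1%:R * T / (N * 2 ^ k)%:R) w
          - X (j%:R * T / (N * 2 ^ k)%:R) w| `^ q)%:E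
  <= (2 * (A * T `^ gam * N%:R `^ (1 - gam)) / (2 ^ (k + 1))%:R)%:E)%E.
Proof.
set h := (N * 2 ^ k)%N.
have N0 : 0 < N%:R :> R by rewrite ltr0n.
have W0 : 0 < (2 ^ k)%:R :> R by rewrite ltr0n expn_gt0.
have h0 : 0 < h%:R :> R by rewrite natrM mulr_gt0.
apply: (@le_trans _ _ (((2 ^ k)%:R `^ (gam / 2))%:E *
     \sum_(j < h) (A * (T / h%:R) `^ gam)%:E)%E).
  rewrite lee_pmul2l ?lte_fin ?powR_gt0//; apply: lee_sum => -[j jN] _ /=.
  have e : j.+1%:R * T / h%:R - j%:R * T / h%:R = T / h%:R.
    by rewrite -natr1; ring.
  have Th : 0 < T / h%:R by rewrite divr_gt0.
  rewrite -[X in (X) `^ gam](ger0_norm (ltW Th)) -e; apply: X_moment.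
  - by apply: grid_in; [exact: ltnW|exact: leq_ltn_trans jN].
  - by apply: grid_in => //; exact: leq_ltn_trans jN.
  - by rewrite eq_sym -subr_eq0 e gt_eqF.
rewrite sumEFin sumr_const card_ord -EFinM lee_fin -[_ *+ h]mulr_natr.
have -> : (T / h%:R) `^ gam = T `^ gam * h%:R `^ (- gam).
  rewrite powRM ?invr_ge0 ?(ltW T_gt0)//.
  by rewrite -[h%:R^-1]powR_inv1 ?ler0n// -powRrM mulN1r.
have hE : h%:R `^ (- gam) * h%:R = N%:R `^ (1 - gam) * (2 ^ k)%:R `^ (1 - gam).
  rewrite -powRM ?ltW// -natrM -/h addrC powRD ?powRr1 ?ltW//.
  by apply/implyP => _; rewrite gt_eqF.
have lhsE : (2 ^ k)%:R `^ (gam / 2) * (A * (T `^ gam * h%:R `^ (- gam)) * h%:R)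
  = A * T `^ gam * N%:R `^ (1 - gam) * (2 ^ k)%:R `^ (1 - gam / 2).
  have -> : (2 ^ k)%:R `^ (1 - gam / 2)
      = (2 ^ k)%:R `^ (gam / 2) * (2 ^ k)%:R `^ (1 - gam).
    rewrite -powRD; last by apply/implyP => _; rewrite gt_eqF.
    by congr (_ `^ _); field.
  have mulACA (a b c f u v : R) : b * c = u * v ->
      f * (A * (a * b) * c) = A * a * u * (f * v).
    by move=> bc; transitivity (A * a * f * (b * c)); [ring|rewrite bc; ring].
  exact: mulACA hE.
rewrite lhsE.
have -> : 2 * (A * T `^ gam * N%:R `^ (1 - gam)) / (2 ^ (k + 1))%:R
   = A * T `^ gam * N%:R `^ (1 - gam) * (2 ^ k)%:R `^ (-1).
  rewrite powR_inv1 ?ltW// addn1 expnS natrM; field.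
  by rewrite gt_eqF// pnatr_eq0.
rewrite ler_wpM2l ?mulr_ge0 ?powR_ge0//.
have exp_le : 1 - gam / 2 <= -1.
  rewrite -subr_ge0 (_ : -1 - _ = (gam - 4) / 2); last by field.
  by rewrite divr_ge0// subr_ge0.
by apply: ler_powR; rewrite // ler1n expn_gt0.
Qed.

(** Expectation and nonnegative sums are exchanged. In the constant, the summand 2 comes from the
    nodes and [2 * T^gam] from the geometric series over the levels. *)
Lemma integral_energy_le :
  (\int[P]_w energy N q gam X Y w
    <= (A * (2 + 2 * T `^ gam) * N%:R `^ (1 - gam))%:E)%E.
Proof.
have N0 : 0 < N%:R :> R by rewrite ltr0n.
rewrite /energy ge0_integralD//=; last first.
  by move=> w _; apply: nneseries_ge0 => k _ _; exact: level_ge0.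
rewrite mulrDr mulrDl EFinD; apply: leeD.
  rewrite /node_error.
  rewrite ge0_integral_sum//=; last by move=> n; exact: merr.
  apply: (@le_trans _ _ (\sum_(n < N.+1) (A * N%:R `^ (- gam))%:E)%E).
    by apply: lee_sum => -[n nN] _ /=; exact: XY_moment.
  rewrite sumEFin sumr_const card_ord lee_fin -[_ *+ N.+1]mulr_natr.
  rewrite addrC powRD; last first.
    by apply/implyP => _; rewrite gt_eqF.
  rewrite powRr1 ?ler0n// -!mulrA ler_wpM2l// mulrCA ler_wpM2l ?powR_ge0//.
  (* The [N + 1] nodes number at most [2 * N], since [N] is positive. *)
  by rewrite -natrM ler_nat mul2n -addnn -addn1 leq_add2l.
rewrite integral_nneseries//.
apply: (@le_trans _ _ (\sum_(k <oo)
   (2 * (A * T `^ gam * N%:R `^ (1 - gam)) / (2 ^ (k + 1))%:R)%:E)%E).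
  apply: lee_nneseries => [k _ _|k _].
    by apply: integral_ge0 => w _; exact: level_ge0.
  rewrite ge0_integralZl_EFin ?powR_ge0// /dyadic_incr.
  by rewrite ge0_integral_sum//=; [exact: level_moment_le|move=> j; exact: minc].
have /cvg_lim -> // := @cvg_geometric_eseries_half R
  (2 * (A * T `^ gam * N%:R `^ (1 - gam))) 0.
by rewrite lee_fin expr0 divr1 le_eqVlt; apply/orP; left; apply/eqP; ring.
Qed.

End moments.
End energy.

(** * Moment bounds from the finite norms *)

Lemma ereal_sup_ge0 (R : realType) (S : set (\bar R)) (x : \bar R) :
  (S x -> 0 <= x -> 0 <= ereal_sup S)%E.
Proof. by move=> Sx x0; exact: le_trans (ereal_sup_ubound Sx). Qed.

Section moment_bounds.
Context {d : measure_display} {Omega : measurableType d} {R : realType}.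
Context {E : normedModType R}.
Variables (P : probability Omega R) (T : R) (T_gt0 : 0 < T) (beta q : R).
Variables (X : R -> Omega -> E) (Y : nat -> R -> Omega -> E).
Hypothesis q_gt0 : 0 < q.
Hypothesis finite_norms : (holder_norm P T beta q X +
      ereal_sup [set (N%:R `^ beta)%:E *
          ereal_sup [set LpE P q (fun w => X (n%:R * T / N%:R) w
                                         - Y N (n%:R * T / N%:R) w)%R
                    | n in [set n : nat | (n <= N)%N]]
        | N in [set N : nat | (0 < N)%N]] < +oo)%E.

(** All the suprema are nonnegative, so finiteness of their sum passes to each. The sum of the q-th
    powers of the Hoelder seminorm and of the weighted nodal supremum serves as a common [A]. *)
Lemma finite_norms_moment : exists A : R, [/\ 0 <= A,
  (forall s t, s \in `[0, T] -> t \in `[0, T] -> s != t ->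
    (\int[P]_w (`|X t w - X s w| `^ q)%:E <=
       (A * `|t - s| `^ (beta * q))%:E)%E) &
  (forall N n, (0 < N)%N -> (n <= N)%N ->
    (\int[P]_w (`|X (n%:R * T / N%:R) w - Y N (n%:R * T / N%:R) w| `^ q)%:E
       <= (A * N%:R `^ (- (beta * q)))%:E)%E)].
Proof.
move: finite_norms; rewrite /holder_norm.
set S1 := (X in (X + _ + _)%E); set S2 := (X in (_ + X + _)%E).
set S3 := (X in (_ + _ + X)%E).
have in0 : 0 \in `[0, T] by rewrite in_itv/= lexx ltW.
have inT : T \in `[0, T] by rewrite in_itv/= lexx ltW.
(* An empty supremum would be -oo, so each index set needs a witness: time 0, the pair (0, T),
   [N = 1] with node 0. *)
have S1_ge0 : (0 <= S1)%E.
  by apply: (@ereal_sup_ge0 _ _ (LpE P q (X 0))); [exists 0|exact: Lnorm_ge0].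
have S2_ge0 : (0 <= S2)%E.
  apply: ereal_sup_ge0; first by exists (0, T) => //; split => //; rewrite lt_eqF.
  by rewrite mule_ge0 ?Lnorm_ge0// lee_fin invr_ge0 powR_ge0.
have S3_ge0 : (0 <= S3)%E.
  apply: ereal_sup_ge0; first by exists 1%N.
  rewrite mule_ge0 ?lee_fin ?powR_ge0//.
  apply: ereal_sup_ge0; first by exists 0%N.
  exact: Lnorm_ge0.
move=> fin.
have S2_fin : (S2 < +oo)%E.
  by apply: le_lt_trans fin; rewrite -addeA addeCA leeDl// adde_ge0.
have S3_fin : (S3 < +oo)%E by apply: le_lt_trans fin; rewrite leeDr// adde_ge0.
have S2E : S2 = (fine S2)%:E by rewrite fineK// ge0_fin_numE.
have S3E : S3 = (fine S3)%:E by rewrite fineK// ge0_fin_numE.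
have C2_ge0 : 0 <= fine S2 by exact: fine_ge0.
have C3_ge0 : 0 <= fine S3 by exact: fine_ge0.
exists (fine S2 `^ q + fine S3 `^ q); split.
- by rewrite addr_ge0 ?powR_ge0.
- move=> s t si ti st.
  have ts0 : 0 < `|t - s| `^ beta.
    by rewrite powR_gt0// normr_gt0 subr_eq0 eq_sym.
  apply: (@le_trans _ _ ((fine S2 * `|t - s| `^ beta) `^ q)%:E).
    apply: LpE_moment => //; first by rewrite mulr_ge0// ltW.
    rewrite EFinM -S2E -lee_pdivrMr//.
    by apply: ereal_sup_ubound; exists (s, t).
  rewrite lee_fin powRM// ?powR_ge0// -powRrM ler_wpM2r ?powR_ge0//.
  by rewrite lerDl powR_ge0.
- move=> N n N0 nN.
  have Nb0 : 0 < N%:R `^ beta :> R by rewrite powR_gt0// ltr0n.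
  apply: (@le_trans _ _ ((fine S3 * N%:R `^ (- beta)) `^ q)%:E).
    apply: LpE_moment => //; first by rewrite mulr_ge0// powR_ge0.
    rewrite powRN EFinM -S3E lee_pdivlMr// muleC.
    apply: (@le_trans _ _ ((N%:R `^ beta)%:E *
      ereal_sup [set LpE P q (fun w => X (n%:R * T / N%:R) w
                                         - Y N (n%:R * T / N%:R) w)%R
                    | n in [set n : nat | (n <= N)%N]])%E).
      by rewrite lee_pmul2l ?lte_fin//; apply: ereal_sup_ubound; exists n.
    by apply: ereal_sup_ubound; exists N.
  rewrite lee_fin powRM// ?powR_ge0// -powRrM mulNr ler_wpM2r ?powR_ge0//.
  by rewrite lerDr powR_ge0.
Qed.

End moment_bounds.

(** * Uniform error at fixed [N], and the rate *)

Lemma integral_sup_error_le {d : measure_display} {Omega : measurableType d}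
    {R : realType} {E : normedModType R} (P : probability Omega R)
    (T beta p q A : R) (N : nat) (X Y : R -> Omega -> E) :
  0 < T -> (0 < N)%N -> 0 < beta -> 0 < p -> p <= q -> 4 <= beta * q ->
  0 <= A ->
  (forall t, t \in `[0, T] -> strongly_measurable (X t)) ->
  (forall t, t \in `[0, T] -> strongly_measurable (Y t)) ->
  continuous_paths T X ->
  (forall w t, t \in `[0, T] -> Y t w = interp T N (Y ^~ w) t) ->
  (forall s t, s \in `[0, T] -> t \in `[0, T] -> s != t ->
    (\int[P]_w (`|X t w - X s w| `^ q)%:E <=
       (A * `|t - s| `^ (beta * q))%:E)%E) ->
  (forall n, (n <= N)%N ->
    (\int[P]_w (`|X (n%:R * T / N%:R) w - Y (n%:R * T / N%:R) w| `^ q)%:E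
       <= (A * N%:R `^ (- (beta * q)))%:E)%E) ->
  (\int[P]_w ereal_sup [set (`|X t w - Y t w| `^ p)%:E | t in `[0%R, T]] <=
   ((N%:R `^ (q^-1 - beta)) `^ p *
     (1 + (2 + (1 - 2 `^ (- (beta / 2)))^-1) `^ q *
          (A * (2 + 2 * T `^ (beta * q)))))%:E)%E.
Proof.
move=> T0 N0 b0 p0 pq g4 A0 mX mY Xc YE Xm XYm.
have q0 : 0 < q by exact: lt_le_trans pq.
have NR0 : 0 < N%:R :> R by rewrite ltr0n.
set a := N%:R `^ (q^-1 - beta); set B := _ `^ q; set K := A * _.
have a0 : 0 < a by rewrite powR_gt0.
have B0 : 0 <= B by rewrite powR_ge0.
(* a ^ q has the order of the mean energy, so that splitting at u = a does the
   work of Jensen's inequality between the moments of order p and q. *)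
pose c := a `^ (p - q) * B.
have c0 : 0 <= c by rewrite mulr_ge0// powR_ge0.
have e0 w : (0 <= energy T N q (beta * q) X Y w)%E by exact: energy_ge0.
have me : measurable_fun setT (energy T N q (beta * q) X Y).
  exact: measurable_energy.
(* [powR_le_split] and then the pathwise energy bound are applied at each [t]; the resulting
   majorant is free of [t], hence bounds the supremum, and is measurable. *)
apply: (@le_trans _ _
  (\int[P]_w ((a `^ p)%:E + c%:E * energy T N q (beta * q) X Y w))%E).
  apply: ge0_le_integralT => w.
    apply: (@ereal_sup_ge0 _ _ (`|X 0 w - Y 0 w| `^ p)%:E).
      by exists 0 => //=; rewrite in_itv/= lexx ltW.
    by rewrite lee_fin powR_ge0.
  apply: ge_ereal_sup => _ [t tT <-].
  apply: (@le_trans _ _ ((a `^ p)%:E +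
      (a `^ (p - q))%:E * (`|X t w - Y t w| `^ q)%:E)%E).
    by rewrite -EFinM -EFinD lee_fin powR_le_split.
  rewrite leeD2l// EFinM -muleA lee_wpmul2l ?lee_fin ?powR_ge0//.
  by rewrite YE//; exact: dist_interp_le_energy.
rewrite ge0_integralD//=; last 3 first.
- by move=> _ _; rewrite lee_fin powR_ge0.
- by move=> w _; rewrite mule_ge0.
- exact: measurable_funeM.
rewrite integral_cst// [X in (_ * X + _)%E](_ : _ = 1%E); last first.
  exact: (probability_setT P).
rewrite mule1 ge0_integralZl_EFin//.
apply: (@le_trans _ _ ((a `^ p)%:E +
    c%:E * (K * N%:R `^ (1 - beta * q))%:E)%E).
  by rewrite leeD2l// lee_wpmul2l// integral_energy_le.
have -> : N%:R `^ (1 - beta * q) = a `^ q.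
  by rewrite /a -powRrM; congr (_ `^ _); field; rewrite gt_eqF.
have aE : a `^ (p - q) * a `^ q = a `^ p.
  by rewrite -powRD ?subrK//; apply/implyP => _; rewrite gt_eqF.
rewrite -EFinM -EFinD lee_fin -aE /c le_eqVlt; apply/orP; left; apply/eqP.
ring.
Qed.

Theorem corollary1p2 (R : realType) (T : R) (T_gt0 : 0 < T)
  (d : measure_display) (Omega : measurableType d) (P : probability Omega R)
  (E : completeNormedModType R) (beta : R) (beta01 : 0 < beta <= 1)
  (X : R -> Omega -> E) (Y : nat -> R -> Omega -> E)
  (X_meas : forall t, t \in `[0, T] -> strongly_measurable (X t))
  (X_cont : continuous_paths T X)
  (Y_meas : forall N t, (0 < N)%N -> t \in `[0, T] ->
     strongly_measurable (Y N t))
  (Y_cont : forall N, (0 < N)%N -> continuous_paths T (Y N))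
  (XY : forall p : R, 1 < p ->
     (forall N, (0 < N)%N -> forall w t, t \in `[0, T] ->
        Y N t w = interp T N (Y N ^~ w) t) /\
     (holder_norm P T beta p X +
      ereal_sup [set (N%:R `^ beta)%:E *
          ereal_sup [set LpE P p (fun w => X (n%:R * T / N%:R) w
                                         - Y N (n%:R * T / N%:R) w)%R
                    | n in [set n : nat | (n <= N)%N]]
        | N in [set N : nat | (0 < N)%N]] < +oo)%E) :
  forall p epsilon : R, 0 < p -> 0 < epsilon ->
  (ereal_sup [set (N%:R `^ (beta - epsilon))%:E *
      (\int[P]_w ereal_sup [set (`|X t w - Y N t w| `^ p)%:E
                           | t in `[0%R, T]]) `^ p^-1
    | N in [set N : nat | (0 < N)%N]] < +oo)%E.
Proof.
move=> p epsilon p0 e0; case/andP: beta01 => b0 _.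
(* The summands secure in turn [p <= q], [q^-1 <= epsilon], [4 <= beta * q] and [1 < q]. *)
pose q := p + epsilon^-1 + 4 / beta + 2.
have ei0 : 0 < epsilon^-1 by rewrite invr_gt0.
have bi0 : 0 < 4 / beta by rewrite divr_gt0.
have [q1 pq eq bq] : [/\ 1 < q, p <= q, epsilon^-1 <= q & 4 / beta <= q].
  by rewrite /q; split; lra.
have q0 : 0 < q by lra.
have g4 : 4 <= beta * q by rewrite mulrC -ler_pdivrMr.
have qe : q^-1 <= epsilon by rewrite -[epsilon]invrK lef_pV2 ?posrE.
have [YE fin] := XY q q1.
have [A [A0 Xm XYm]] := finite_norms_moment T_gt0 q0 fin.
set M := 1 + (2 + (1 - 2 `^ (- (beta / 2)))^-1) `^ q *
          (A * (2 + 2 * T `^ (beta * q))).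
apply: (@le_lt_trans _ _ (M `^ p^-1)%:E); last exact: ltry.
apply: ge_ereal_sup => _ [N /= N0 <-].
have N1 : 1 <= N%:R :> R by rewrite ler1n.
have NR0 : 0 < N%:R :> R by rewrite ltr0n.
have M0 : 0 <= M.
  by rewrite addr_ge0// mulr_ge0 ?powR_ge0// mulr_ge0// addr_ge0// mulr_ge0//
    powR_ge0.
have := @integral_sup_error_le _ _ _ _ P T beta p q A N X (Y N) T_gt0 N0 b0 p0
  pq g4 A0 X_meas (fun t => Y_meas N t N0) X_cont (YE N N0) Xm
  (fun n => @XYm N n N0).
rewrite -/M; set I := (\int[P]_w _)%E => IM.
have I0 : (0 <= I)%E.
  apply: integral_ge0 => w _.
  apply: (@ereal_sup_ge0 _ _ (`|X 0 w - Y N 0 w| `^ p)%:E).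
    by exists 0 => //=; rewrite in_itv/= lexx ltW.
  by rewrite lee_fin powR_ge0.
have pi0 : 0 <= p^-1 by rewrite invr_ge0 ltW.
have := @gt0_ler_poweR R p^-1 pi0 I _ _ _ IM.
rewrite !in_itv/= !leey !andbT I0 lee_fin mulr_ge0 ?powR_ge0// => /(_ isT isT).
rewrite /= powRM ?powR_ge0// -[X in (X * _)%R]powRrM mulfV ?gt_eqF//.
rewrite powRr1 ?powR_ge0// => Ip.
apply: (@le_trans _ _ ((N%:R `^ (beta - epsilon))%:E *
    (N%:R `^ (q^-1 - beta) * M `^ p^-1)%:E)%E).
  by rewrite lee_wpmul2l// lee_fin powR_ge0.
(* The powers of [N] combine to the exponent [q^-1 - epsilon], which is nonpositive; as [N] is at
   least 1, only the constant built from [M] remains. *)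
rewrite -EFinM lee_fin mulrA ler_piMl ?powR_ge0//.
rewrite -powRD; last by apply/implyP => _; rewrite gt_eqF.
have -> : beta - epsilon + (q^-1 - beta) = q^-1 - epsilon by ring.
by rewrite -[leRHS](powRr0 N%:R) ler_powR// subr_le0.
Qed.
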